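(* Let $(X,\mathfrak A,P)$ and $(Y,\mathfrak B,Q)$ be probability spaces, let $R$ be a skew product of $P$ and $Q$, let $\{(\mathfrak A,S_y):y\in Y\}$ be a regular conditional probability on $\mathfrak A$ with respect to $Q$, and let $\{\tau_y:y\in Y\}$, with $\tau_y$ a lower density for $(X,\mathfrak A,S_y)$, be an equi-admissible family of densities. (a) A real-valued stochastic process $\{\xi_y:y\in Y\}$ on $(X,\mathfrak A,P)$ possesses an equivalent measurable version (that is, there is a measurable process $\{\theta_y:y\in Y\}$ equivalent to it) if and only if it is $R_{\divideontimes}$-measurable, i.e. the function $(x,y)\mapsto\xi_y(x)$ is measurable with respect to $\mathfrak A\divideontimes_R\mathfrak B$. (b) Every modification of a measurable (real-valued) process with the help of admissibly generated liftings is a measurable process.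
   Context: Basic notation. $\mathfrak A\otimes\mathfrak B$ is the product $\sigma$-algebra; a skew product of $P$ and $Q$ is a probability measure $R$ on $\mathfrak A\otimes\mathfrak B$ with marginals $P$ on $X$ and $Q$ on $Y$. Hats denote completions; $\widehat R$ is defined on $\mathfrak A\widehat\otimes_R\mathfrak B$ (the completion of $\mathfrak A\otimes\mathfrak B$ under $R$), $\widehat{S_y}$ on the completion of $\mathfrak A$ under $S_y$. For $W\subset X\times Y$: $W^y=\{x:(x,y)\in W\}$; for a function $f$ on $X\times Y$: $f^y=f(\cdot,y)$. Regular conditional probability on $\mathfrak A$ with respect to $Q$ (for $R$): a family of probability measures $S_y$ on $\mathfrak A$, $y\in Y$, such that for each $A\in\mathfrak A$ there is $N\in\mathfrak B$, $Q(N)=0$, with $y\mapsto S_y(A)$ $\mathfrak B$-measurable on $Y\setminus N$; and $\int_BS_y(A)\,dQ(y)=R(A\times B)$ for all $A\in\mathfrak A,B\in\mathfrak B$. Processes. A (real) stochastic process on $(X,\mathfrak A,P)$ is a family $\{\xi_y:y\in Y\}$ of $\mathfrak A$-measurable functions $\xi_y:X\to\mathbb R$. Two processes $\{\xi_y\}$, $\{\theta_y\}$ are equivalent if $S_y\{x\in X:\xi_y(x)\ne\theta_y(x)\}=0$ for every $y\in Y$. A process $\{\theta_y\}$ is measurable if $(x,y)\mapsto\theta_y(x)$ is $\widehat R$-measurable. Nil sets. $\mathcal N:=\{E\subset X\times Y:\exists N\in\mathfrak B,\ Q(N)=0,\ \forall y\notin N:\ \widehat{S_y}(E^y)=0\}$;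 $\mathfrak A\divideontimes_R\mathfrak B:=\{W\triangle N: W\in\mathfrak A\otimes\mathfrak B,\ N\in\mathcal N\}$ and $R_{\divideontimes}(W\triangle N):=R(W)$; $R_{\divideontimes}$ is a complete measure extending $\widehat R$. A lower density for a probability space $(Z,\mathfrak D,S)$ is a map $\delta:\mathfrak D\to\mathfrak D$ with $S(\delta(A)\triangle A)=0$; $\delta(A)=\delta(B)$ whenever $S(A\triangle B)=0$; $\delta(\emptyset)=\emptyset$, $\delta(Z)=Z$; $\delta(A\cap B)=\delta(A)\cap\delta(B)$. A lifting is a lower density which also satisfies $\delta(A^c)=\delta(A)^c$; it induces in the standard way a (multiplicative, linear, positive) lifting on the bounded $S$-measurable functions, denoted by the same letter, with $\delta(\chi_A)=\chi_{\delta(A)}$. If $\mathfrak E\subset\mathfrak D$ is a sub-$\sigma$-algebra, an $\mathfrak E$-envelope of $A\subset Z$ is a set $E\in\mathfrak E$, $E\supset A$, such that the inner measure generated by $S|_{\mathfrak E}$ of $E\setminus A$ is $0$. Equi-admissible family (here on $\mathfrak A$). Let $\mathfrak A=\sigma(\{M_\alpha:\alpha<\kappa\})$, where $\kappa$ is the least ordinal such that $\mathfrak A$ is generated by a family indexed by the ordinals less than $\kappa$. Put $\mathfrak A_{y0}=\{A\in\mathfrak A:S_y(A)=0\}$ and, for $\gamma\le\kappa$, $\mathfrak A_{y\gamma}^{*}=\sigma(\{M_\alpha:\alpha<\gamma\}\cup\mathfrak A_{y0})$. Fix, independently of $y$, for every limit ordinal $\gamma\le\kappa$ of countable cofinality one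 increasing sequence $(\gamma_n)$ cofinal in $\gamma$. For each $y\in Y$ define lower densities $\tau_{y,\gamma}$ for $S_y|_{\mathfrak A^*_{y\gamma}}$ by transfinite recursion: (i) $\tau_{y,0}(B)=\emptyset$ if $S_y(B)=0$ and $\tau_{y,0}(B)=X$ otherwise, for $B\in\sigma(\mathfrak A_{y0})$; (ii) if $\gamma$ is a limit ordinal of uncountable cofinality, then $\mathfrak A^*_{y\gamma}=\bigcup_{\alpha<\gamma}\mathfrak A^*_{y\alpha}$ and $\tau_{y,\gamma}(B)=\tau_{y,\alpha}(B)$ for $B\in\mathfrak A^*_{y\alpha}$, $\alpha<\gamma$; (iii) if $\gamma$ is a limit ordinal of countable cofinality with the fixed sequence $(\gamma_n)$, then $\tau_{y,\gamma}(B)=\bigcap_{k}\bigcup_{n}\bigcap_{m\ge n}\tau_{y,\gamma_m}\big(\{\mathbb E^y_{\mathfrak A^*_{y\gamma_m}}(\chi_B)>1-1/k\}\big)$ for $B\in\mathfrak A^*_{y\gamma}$, where $\mathbb E^y$ denotes conditional expectation under $S_y$; (iv) if $\gamma=\beta+1$, $M=M_\beta$, and $V_1\supset M$, $V_2\supset M^c$ are $\mathfrak A^*_{y\beta}$-envelopes of $M$, $M^c$ with respect to $S_y$, then for $G,H\in\mathfrak A^*_{y\beta}$, $\tau_{y,\gamma}((G\cap M)\cup(H\cap M^c))=\big[M\cap\tau_{y,\beta}((G\cap V_1)\cup(H\cap V_1^c))\big]\cup\big[M^c\cap\tau_{y,\beta}((H\cap V_2)\cup(G\cap V_2^c))\big]$.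 Then $\tau_y:=\tau_{y,\kappa}$ is a lower density for $S_y$ on $\mathfrak A$, and $\{\tau_y:y\in Y\}$ is called the equi-admissible family of densities determined by $\{M_\alpha:\alpha<\kappa\}$ (and the fixed cofinal sequences). Admissibly generated liftings. A lifting $\sigma_y$ for $\widehat{S_y}$ is admissibly generated by $\tau_y$ if $\tau_y(A)\subset\sigma_y(A)$ for every $A\in\mathfrak A$. In the present setting there exist such liftings $\sigma_y$ ($y\in Y$) together with a lifting $\pi:\mathfrak A\divideontimes_R\mathfrak B\to\mathfrak A\widehat\otimes_R\mathfrak B$ for $R_{\divideontimes}$ satisfying $[\pi(E)]^y=\sigma_y([\pi(E)]^y)$ for all $y\in Y$ and $E\triangle\pi(E)\in\mathcal N$, for all $E\in\mathfrak A\divideontimes_R\mathfrak B$. Modification with the help of admissibly generated liftings. The paper gives no separate definition of this phrase. The modification carried out in its proof is the following. Let $\Xi(x,y)=\xi_y(x)$ be $R_{\divideontimes}$-measurable. If $\Xi$ is bounded, there is $N_1\in\mathfrak B$ with $Q(N_1)=0$ such that $[\pi(\Xi)]^y=\sigma_y(\Xi^y)$ $\widehat{S_y}$-a.e. for $y\notin N_1$, and the modified process is $\sigma_y([\pi(\Xi)]^y)$ for $y\notin N_1$ and $\xi_y$ for $y\in N_1$. If $\Xi$ is arbitrary, $X\times Y$ is decomposed into at most countably many pairwise disjoint sets $\Omega_n\in\mathfrak A\divideontimes_R\mathfrak B$ on each of which $\Xi$ is bounded, the previous step is applied to each $\Xi\chi_{\Omega_n}$ (with exceptional $Q$-null sets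 $N_n$), and the resulting functions are glued together along the sets $\pi(\Omega_n)\cap(X\times N_n^c)$, the process being left equal to $\xi_y(x)$ on $\bigcup_n(X\times N_n)\cup\bigcap_n\pi(\Omega_n^c)$.
   Formalization: In (b), each random variable of the modified process is claimed measurable only for the completion of 𝔄 under S_y, not 𝔄-measurable as the definition of process requires, since values of the liftings σ_y need not lie in 𝔄; joint R̂-measurability is as stated. *)

(* Defs.v *)
From HB Require Import structures.
From mathcomp Require Import all_boot all_order all_algebra.
From mathcomp Require Import all_classical all_reals all_analysis.
From mathcomp Require Import measurable_realfun.

Set Implicit Arguments.
Unset Strict Implicit.
Unset Printing Implicit Defensive.

Import Order.TTheory GRing.Theory Num.Theory.
Import numFieldNormedType.Exports.

Local Open Scope classical_set_scope.
Local Open Scope ring_scope.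

(* Several sigma-algebras live on the same carrier, so measurability is taken
   with respect to an explicit family of sets D. *)
Definition measurable_wrt (K : realType) (T : Type) (D : set (set T))
    (f : T -> K) : Prop :=
  forall B : set K, measurable B -> D (f @^-1` B).

(* [m] is the measure (an arbitrary set function outside [D]); [delta] is only
   constrained on [D]. *)
Definition lower_density (K : realType) (T : Type) (D : set (set T))
    (m : set T -> \bar K) (delta : set T -> set T) : Prop :=
  [/\ forall A, D A -> D (delta A) /\ m (delta A `+` A) = 0%E,
      forall A B, D A -> D B -> m (A `+` B) = 0%E -> delta A = delta B,
      delta set0 = set0,
      delta setT = setT &
      forall A B, D A -> D B -> delta (A `&` B) = delta A `&` delta B].

Definition lifting (K : realType) (T : Type) (D : set (set T))
    (m : set T -> \bar K) (delta : set T -> set T) : Prop :=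
  lower_density D m delta /\ forall A, D A -> delta (~` A) = ~` delta A.

(* The lifting of bounded measurable functions induced by a lifting of sets:
   the multiplicative positive linear extension of [delta], given by
   lift_fun delta f z = sup {r | z \in delta {f > r}}. *)
Definition lift_fun (K : realType) (T : Type) (delta : set T -> set T)
    (f : T -> K) : T -> K :=
  fun z => sup [set r : K | delta [set t | r < f t] z].

Lemma lift_fun_indic (K : realType) (T : Type) (delta : set T -> set T)
    (A : set T) :
  delta set0 = set0 -> delta setT = setT ->
  lift_fun delta (\1_A : T -> K) = \1_(delta A).
Proof.
move=> d0 dT; apply/funext => z; rewrite /lift_fun.
have neg (r : K) : r < 0 -> [set t | r < (\1_A : T -> K) t] = setT.
  move=> r0; apply/seteqP; split => // t _ /=.
  by rewrite indicE (lt_le_trans r0).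
have mid (r : K) : 0 <= r < 1 -> [set t | r < (\1_A : T -> K) t] = A.
  case/andP => r0 r1; apply/seteqP; split => t /=; rewrite indicE.
    by case: (boolP (t \in A)) => [/set_mem//|_] /=; rewrite ltNge r0.
  by move=> At; rewrite mem_set.
have big (r : K) : 1 <= r -> [set t | r < (\1_A : T -> K) t] = set0.
  move=> r1; apply/seteqP; split => // t /=; rewrite indicE ltNge.
  by case: (t \in A) => /=; rewrite ?r1// (le_trans _ r1).
have ray (a : K) : sup [set` `]-oo, a[] = a.
  exact: sup_itv.
have [dAz|dAz] := pselect (delta A z).
- rewrite indicE mem_set//= -[RHS](ray 1); congr (sup _).
  apply/seteqP; split => r /=; rewrite in_itv/=.
    by rewrite ltNge; apply: contraPN => /big ->; rewrite d0.
  move=> r1; have [r0|r0] := ltP r 0; first by rewrite neg// dT.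
  by rewrite mid ?r0.
- rewrite indicE memNset//= -[RHS](ray 0); congr (sup _).
  apply/seteqP; split => r /=; rewrite in_itv/=.
    rewrite ltNge; apply: contraPN => r0.
    have [r1|r1] := ltP r 1; first by rewrite mid ?r0.
    by rewrite big// d0.
  by move=> r0; rewrite neg// dT.
Qed.

(* [ereal_sup ...] is the inner measure of E \ A generated by m on D. *)
Definition envelope (K : realType) (T : Type) (D : set (set T))
    (m : set T -> \bar K) (A E : set T) : Prop :=
  [/\ D E, A `<=` E &
      ereal_sup [set m F | F in [set F | D F /\ F `<=` E `\` A]] = 0%E].

(* [g] is a version of the conditional expectation of [f] given [D]. *)
Definition condexp (K : realType) (d : measure_display) (X : measurableType d)
    (mu : probability X K) (D : set (set X)) (f g : X -> K) : Prop :=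
  [/\ measurable_wrt D g,
      mu.-integrable setT (EFin \o g) &
      forall E, D E ->
        (\int[mu]_(x in E) (g x)%:E = \int[mu]_(x in E) (f x)%:E)%E].

(* Ordinals are represented by the points of a well-ordered type [O]: a point
   stands for the order type of its set of strict predecessors. *)
Section ordinals.
Context (dO : Order.disp_t) (O : orderType dO).
Implicit Types a b c k : O.

Definition ord_is_zero c : Prop := forall a, ~~ (a < c)%O.

Definition ord_is_succ b c : Prop :=
  (b < c)%O /\ forall a, (a < c)%O -> (a <= b)%O.

Definition ord_is_limit c : Prop :=
  ~ ord_is_zero c /\ forall b, (b < c)%O -> exists2 a, (b < a)%O & (a < c)%O.

Definition cofinal_seq c (s : nat -> O) : Prop :=
  [/\ increasing_seq s, forall n, (s n < c)%O &
      forall a, (a < c)%O -> exists n, (a <= s n)%O].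

Definition countable_cofinality c : Prop := exists s, cofinal_seq c s.

End ordinals.

Section admissible.
Context (K : realType) (d1 d2 : measure_display).
Context (X : measurableType d1) (Y : measurableType d2).

(* [k] is the least ordinal such that the sigma-algebra of X is generated by a
   family indexed by the ordinals less than [k], and [M] is such a family (its
   values outside of the initial segment are irrelevant). *)
Definition minimal_generator (dO : Order.disp_t) (O : orderType dO) (k : O)
    (M : O -> set X) : Prop :=
  (measurable : set (set X)) = <<s M @` [set a | (a < k)%O] >> /\
  forall b, (b < k)%O -> ~ exists M' : O -> set X,
    (measurable : set (set X)) = <<s M' @` [set a | (a < b)%O] >>.

Definition null_sets (mu : probability X K) : set (set X) :=
  [set A | measurable A /\ mu A = 0%E].

Definition approx_algebra (mu : probability X K) (dO : Order.disp_t)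
    (O : orderType dO) (M : O -> set X) (c : O) : set (set X) :=
  <<s M @` [set a | (a < c)%O] `|` null_sets mu >>.

(* The transfinite recursion for a single measure [mu] = S_y, where [t c] is
   tau_{y,c}.  In the limit case of countable cofinality and in the successor
   case the right-hand side depends neither on the versions of the conditional
   expectations nor on the envelopes.  The index [j] below is k - 1. *)
Definition admissible_recursion (mu : probability X K) (dO : Order.disp_t)
    (O : orderType dO) (k : O) (M : O -> set X) (cof : O -> nat -> O)
    (t : O -> set X -> set X) : Prop :=
  let D := approx_algebra mu M in
  forall c, (c <= k)%O ->
  [/\ lower_density (D c) mu (t c),
      ord_is_zero c -> forall B, D c B ->
        (mu B = 0%E -> t c B = set0) /\ (mu B <> 0%E -> t c B = setT),
      ord_is_limit c -> ~ countable_cofinality c ->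
        forall a B, (a < c)%O -> D a B -> t c B = t a B,
      ord_is_limit c -> countable_cofinality c ->
        forall B (g : nat -> X -> K), D c B ->
        (forall m, condexp mu (D (cof c m)) \1_B (g m)) ->
        t c B = \bigcap_j \bigcup_n \bigcap_(m in [set m | (n <= m)%N])
                  t (cof c m) [set x | 1 - j.+1%:R^-1 < g m x] &
      forall b, ord_is_succ b c ->
        forall V1 V2, envelope (D b) mu (M b) V1 ->
        envelope (D b) mu (~` M b) V2 ->
        forall G H, D b G -> D b H ->
        t c ((G `&` M b) `|` (H `&` ~` M b)) =
          (M b `&` t b ((G `&` V1) `|` (H `&` ~` V1))) `|`
          (~` M b `&` t b ((H `&` V2) `|` (G `&` ~` V2)))].

(* [M] and the cofinal sequences [cof] do not depend on y. *)
Definition equi_admissible (S : Y -> probability X K)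
    (tau : Y -> set X -> set X) : Prop :=
  exists (dO : Order.disp_t) (O : orderType dO) (k : O) (M : O -> set X)
    (cof : O -> nat -> O) (t : Y -> O -> set X -> set X),
  [/\ well_founded (fun a b : O => (a < b)%O),
      minimal_generator k M,
      forall c, (c <= k)%O -> ord_is_limit c -> countable_cofinality c ->
        cofinal_seq c (cof c),
      forall y, admissible_recursion (S y) k M cof (t y) &
      forall y A, measurable A -> tau y A = t y k A].

Definition skew_product (P : probability X K) (Q : probability Y K)
    (R : probability (X * Y)%type K) : Prop :=
  (forall A, measurable A -> R (A `*` setT) = P A) /\
  (forall B, measurable B -> R (setT `*` B) = Q B).

(* y |-> S y A is only measurable off a Q-null set.  The library integral of a
   nonnegative function is a supremum over simple functions, hence insensitive
   to this null set. *)
Definition regular_conditional_probability (Q : probability Y K)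
    (R : probability (X * Y)%type K) (S : Y -> probability X K) : Prop :=
  (forall A, measurable A -> exists N, [/\ measurable N, Q N = 0%E &
     measurable_fun (~` N) (fun y => S y A)]) /\
  (forall A B, measurable A -> measurable B ->
     (\int[Q]_(y in B) S y A = R (A `*` B))%E).

Definition nil_sets (Q : probability Y K) (S : Y -> probability X K) :
    set (set (X * Y)) :=
  [set E | exists N, [/\ measurable N, Q N = 0%E &
     forall y, ~ N y -> (S y).-negligible (ysection E y)]].

Definition nil_algebra (Q : probability Y K) (S : Y -> probability X K) :
    set (set (X * Y)) :=
  [set W `+` N | W in measurable & N in nil_sets Q S].

(* nil_measure (W `+` N) = R W for W measurable and N a nil set: the values
   over which the infimum is taken all coincide. *)
Definition nil_measure (Q : probability Y K) (S : Y -> probability X K)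
    (R : probability (X * Y)%type K) (E : set (X * Y)) : \bar K :=
  ereal_inf
    [set R W | W in [set W | measurable W /\ nil_sets Q S (W `+` E)]].

Definition process (xi : Y -> X -> K) : Prop :=
  forall y, measurable_fun setT (xi y).

Definition process_fun (xi : Y -> X -> K) : X * Y -> K :=
  fun z => xi z.2 z.1.

Definition equivalent_processes (S : Y -> probability X K)
    (xi theta : Y -> X -> K) : Prop :=
  forall y, S y [set x | xi y x <> theta y x] = 0%E.

Definition measurable_process (R : probability (X * Y)%type K)
    (xi : Y -> X -> K) : Prop :=
  measurable_wrt (completed_algebra_gen R) (process_fun xi).

(* [mu_ext mu] is the outer measure of [mu]; on [completed_algebra_gen mu] it
   is the completion of [mu].  The domain of [sigma y] is that completion, so
   the sections of [pi E] are required to belong to it. *)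
Definition admissible_liftings (Q : probability Y K)
    (S : Y -> probability X K) (R : probability (X * Y)%type K)
    (tau : Y -> set X -> set X) (sigma : Y -> set X -> set X)
    (pi : set (X * Y) -> set (X * Y)) : Prop :=
  (forall y,
     lifting (completed_algebra_gen (S y)) (mu_ext (S y)) (sigma y) /\
     forall A, measurable A -> tau y A `<=` sigma y A) /\
  lifting (nil_algebra Q S) (nil_measure Q S R) pi /\
  (forall E, nil_algebra Q S E ->
     [/\ completed_algebra_gen R (pi E),
         forall y, completed_algebra_gen (S y) (ysection (pi E) y) /\
           ysection (pi E) y = sigma y (ysection (pi E) y) &
         nil_sets Q S (E `+` pi E)]).

Definition bounded_modification (Q : probability Y K)
    (S : Y -> probability X K) (sigma : Y -> set X -> set X)
    (pi : set (X * Y) -> set (X * Y)) (f : X * Y -> K) (N : set Y)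
    (psi : X * Y -> K) : Prop :=
  [/\ measurable_wrt (nil_algebra Q S) f /\ bounded_fun f,
      measurable N /\ Q N = 0%E,
      forall y, ~ N y ->
        measurable_wrt (completed_algebra_gen (S y)) (fun x => f (x, y)) /\
        {ae S y, forall x,
           lift_fun pi f (x, y) = lift_fun (sigma y) (fun x' => f (x', y)) x},
      forall x y, ~ N y ->
        psi (x, y) = lift_fun (sigma y) (fun x' => lift_fun pi f (x', y)) x &
      forall x y, N y -> psi (x, y) = f (x, y)].

(* [Omega] is a countable partition, some members of which may be empty. *)
Definition glued_modification (Q : probability Y K)
    (S : Y -> probability X K) (sigma : Y -> set X -> set X)
    (pi : set (X * Y) -> set (X * Y)) (f : X * Y -> K) (psi : X * Y -> K) :
    Prop :=
  exists (Omega : nat -> set (X * Y)) (N : nat -> set Y)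
    (psin : nat -> X * Y -> K),
  [/\ [/\ measurable_wrt (nil_algebra Q S) f,
          forall n, nil_algebra Q S (Omega n),
          trivIset setT Omega,
          \bigcup_n Omega n = setT &
          forall n, [bounded f z | z in Omega n]],
      forall n, bounded_modification Q S sigma pi
        (fun z => f z * \1_(Omega n) z) (N n) (psin n),
      forall n x y, pi (Omega n) (x, y) -> (forall m, ~ N m y) ->
        psi (x, y) = psin n (x, y) &
      forall x y, (exists m, N m y) \/ (forall n, pi (~` Omega n) (x, y)) ->
        psi (x, y) = f (x, y)].

Definition modification (Q : probability Y K)
    (S : Y -> probability X K) (sigma : Y -> set X -> set X)
    (pi : set (X * Y) -> set (X * Y)) (xi theta : Y -> X -> K) : Prop :=
  (exists N, bounded_modification Q S sigma pi
     (process_fun xi) N (process_fun theta)) \/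
  glued_modification Q S sigma pi (process_fun xi) (process_fun theta).

(* Process whose random variables are measurable for the completions of the
   S_y.  The random variables of a modification are of the form sigma_y f, and
   sigma_y takes its values in the completion. *)
Definition completed_process (S : Y -> probability X K)
    (xi : Y -> X -> K) : Prop :=
  forall y, measurable_wrt (completed_algebra_gen (S y)) (xi y).

End admissible.

(* Main.v *)
(** For an [R]-null set [W], disintegrating [R W] along the [S y] makes the
    sections of [W] [S y]-null for [Q]-almost every [y]: [R]-null sets are nil
    sets.  Hence a process equivalent to a measurable one is measurable for the
    nil algebra.  Conversely, a function measurable for the nil algebra agrees
    off a nil set with a product-measurable one; replacing the process by the
    sections of the latter, except over the exceptional [Q]-null set of [y]'s
    where the process is kept, yields the equivalent measurable version.

    For (b), the sections of [pi E] are fixed by [sigma y], so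
    [sigma y ([pi f]^y) = [pi f]^y] and the modification of a bounded [f] is
    simply [pi f] off a [Q]-null set of [y]'s. *)
Require Import Defs.
From HB Require Import structures.
From mathcomp Require Import all_boot all_order all_algebra.
From mathcomp Require Import all_classical all_reals all_analysis.
From mathcomp Require Import measurable_realfun.

Set Implicit Arguments.
Unset Strict Implicit.
Unset Printing Implicit Defensive.

Import Order.TTheory GRing.Theory Num.Theory.
Import numFieldNormedType.Exports.

Local Open Scope classical_set_scope.
Local Open Scope ring_scope.

(** * Measurability with respect to a family of sets *)

Lemma measurable_wrt_gt (K : realType) (T : Type) (D : set (set T))
    (f : T -> K) (r : K) : measurable_wrt D f -> D [set z | r < f z].
Proof.
move=> mf; have -> : [set z | r < f z] = f @^-1` `]r, +oo[.
  by apply/seteqP; split => z /=; rewrite in_itv/= andbT.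
by apply: mf; exact: measurable_itv.
Qed.

(** The sets whose preimage lies in [D] form a sigma-algebra, and open upper rays generate the Borel
    sets. *)
Lemma measurable_wrt_ray (K : realType) (T : Type) (D : set (set T))
    (f : T -> K) : sigma_algebra setT D ->
  (forall r, D [set z | r < f z]) -> measurable_wrt D f.
Proof.
move=> [D0 DC DU] Df B mB; move: B mB.
suff : (measurable : set (set K)) `<=` [set B | D (f @^-1` B)] by [].
rewrite [measurable]RGenOInfty.measurableE; apply: smallest_sub; [split|].
- by rewrite /= preimage_set0.
- by move=> B /= /DC; rewrite !setTD preimage_setC.
- by move=> B /= DB; rewrite preimage_bigcup; exact: DU.
- move=> _ [r ->] /=; suff -> : f @^-1` `]r, +oo[ = [set z | r < f z] by [].
  by apply/seteqP; split => z /=; rewrite in_itv/= andbT.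
Qed.

Lemma sigma_algebraI (T : Type) (D : set (set T)) (A B : set T) :
  sigma_algebra setT D -> D A -> D B -> D (A `&` B).
Proof.
move=> [D0 DC DU] DA DB.
have {}DC C : D C -> D (~` C) by move/DC; rewrite setTD.
rewrite -[A `&` B]setCK setCI -bigcup2E; apply/DC/DU => -[|[|n]] //=; exact: DC.
Qed.

Lemma sigma_algebraU (T : Type) (D : set (set T)) (A B : set T) :
  sigma_algebra setT D -> D A -> D B -> D (A `|` B).
Proof. by move=> [D0 _ DU] DA DB; rewrite -bigcup2E; apply: DU => -[|[|n]]. Qed.

(** * Completion of a measure, and integrals over the complement of a null set *)

Section completion.
Import HBNNSimple.
Context (K : realType) (d : measure_display) (T : measurableType d).
Variable mu : {measure set T -> \bar K}.

Lemma sigma_algebra_completed_algebra_gen :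
  sigma_algebra setT (completed_algebra_gen mu).
Proof.
split.
- by exists set0 => //; exists set0; [exact: negligible_set0|rewrite setU0].
- move=> _ [A mA [N [M [mM M0 NM]] <-]].
  (* [M] is a measurable null cover of [N]. Removing [M] instead of [N] keeps the main part
     measurable; the points lost lie in [M], hence form a negligible set. *)
  exists (~` (A `|` M)); first by apply: measurableC; exact: measurableU.
  exists (M `\` (A `|` N)); first by exists M; split => // x [].
  apply/seteqP; split => [x [AM|[Mx AN]]|x [_ /= AN]].
  + by split => // -[Ax|/NM Mx]; apply: AM; [left|right].
  + by split.
  + have [Mx|Mx] := pselect (M x); [by right|left => -[Ax|//]].
    by apply: AN; left.
- move=> F DF.
  have /choice[A hA] n : exists A, measurable A /\
      exists2 N, mu.-negligible N & A `|` N = F n.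
    by have [A mA [N nN AN]] := DF n; exists A; split => //; exists N.
  have /choice[N hN] n : exists N, mu.-negligible N /\ A n `|` N = F n.
    by have [_ [N nN AN]] := hA n; exists N.
  exists (\bigcup_k A k); first by apply: bigcupT_measurable => k; have [] := hA k.
  exists (\bigcup_k N k).
    by apply: negligible_bigcup => k; have [] := hN k.
  by rewrite -bigcupU; apply: eq_bigcup => // k _; have [] := hN k.
Qed.

Lemma measurable_completed_algebra_gen (A : set T) :
  measurable A -> completed_algebra_gen mu A.
Proof.
by move=> mA; exists A => //; exists set0; [exact: negligible_set0|rewrite setU0].
Qed.

(** Off a measurable null cover [M] of the symmetric difference, [E] coincides with [A]; inside [M]
    it is negligible. *)
Lemma completed_algebra_gen_setY (A E : set T) :
  completed_algebra_gen mu A -> mu.-negligible (A `+` E) ->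
  completed_algebra_gen mu E.
Proof.
move=> cA [M [mM M0 AEM]].
have sD := sigma_algebra_completed_algebra_gen.
have -> : E = (A `&` ~` M) `|` (E `&` M).
  apply/seteqP; split => x.
  - move=> Ex; have [Mx|Mx] := pselect (M x); first by right.
    left; split => //; apply: contrapT => Ax; apply: Mx; apply: AEM.
    by right.
  - move=> [[Ax Mx]|[]//]; apply: contrapT => Ex; apply: Mx; apply: AEM.
    by left.
apply: sigma_algebraU => //.
  apply: sigma_algebraI => //; apply: measurable_completed_algebra_gen.
  exact: measurableC.
exists set0 => //; exists (E `&` M); last by rewrite set0U.
by exists M; split => // x [].
Qed.

Lemma measurable_wrt_measurable_fun (f : T -> K) :
  measurable_fun setT f -> measurable_wrt (completed_algebra_gen mu) f.
Proof.
move=> mf B mB; apply: measurable_completed_algebra_gen.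
by rewrite -[_ @^-1` _]setTI; exact: mf.
Qed.

(** Here [f] carries no measurability assumption, because [S y A] is measurable in [y] only off a
    null set. The argument therefore works directly with the integral as a supremum over simple
    functions. *)
Lemma ge0_integral_setD_null (D N : set T) (f : T -> \bar K) :
  measurable N -> mu N = 0%E -> (forall x, D x -> 0 <= f x)%E ->
  (\int[mu]_(x in D) f x = \int[mu]_(x in D `\` N) f x)%E.
Proof.
move=> mN N0 f0.
have f0' x : (D `\` N) x -> (0 <= f x)%E by move=> [Dx _]; exact: f0.
rewrite !ge0_integralE//; apply/eqP; rewrite eq_le; apply/andP; split.
- apply: ge_ereal_sup => _ [h hf <-].
  have mNC := measurableC mN.
  (* Cutting a simple minorant [h] down to the complement of [N] leaves its integral unchanged. *)
  apply: ereal_sup_ubound; exists (proj_nnsfun h mNC).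
    move=> x; rewrite -mrestrict !patchE; have := hf x; rewrite patchE.
    have [Nx _|Nx] := boolP (x \in N).
      rewrite (memNset (_ : ~ (~` N) x)); last by apply; exact: set_mem.
      by case: ifPn => // /set_mem/f0'.
    have {}Nx : ~ N x by move/mem_set => /(negP Nx).
    rewrite (mem_set (Nx : (~` N) x)).
    have [Dx|Dx] := boolP (x \in D).
      by rewrite mem_set//; split => //; exact: set_mem.
    by rewrite memNset// => -[/mem_set/(negP Dx)].
  rewrite -mrestrict -(integral_nnsfun _ mNC).
  transitivity (\int[mu]_x (h x)%:E)%E; last by rewrite integral_nnsfun// patch_setT.
  rewrite [RHS](ge0_negligible_integral mN) ?setTD//.
  - exact/measurable_EFinP.
  - by move=> x _; rewrite lee_fin.
- apply: ge_ereal_sup => _ [h hf <-]; apply: ereal_sup_ubound; exists h => // x.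
  apply: (le_trans (hf x)); rewrite !patchE.
  have [/set_mem[Dx _]|_] := boolP (x \in D `\` N); first by rewrite mem_set.
  by case: ifPn => // /set_mem/f0.
Qed.

End completion.

(** * Disintegration of [R] along the [S y], nil sets and the nil algebra *)

Section disintegration.
Context (K : realType) (d1 d2 : measure_display).
Context (X : measurableType d1) (Y : measurableType d2).
Variables (Q : probability Y K) (R : probability (X * Y)%type K).
Variable S : Y -> probability X K.
Hypothesis hS : regular_conditional_probability Q R S.

(** Dynkin induction from rectangles, where the claim is the defining property of [S]. Measurability
    off a null set is carried through the induction, with a null set depending on [W]. *)
Lemma regular_conditional_probability_ysection (W : set (X * Y)) :
  measurable W ->
  (exists N, [/\ measurable N, Q N = 0%E &
     measurable_fun (~` N) (fun y => S y (ysection W y))]) /\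
  (\int[Q]_y S y (ysection W y) = R W)%E.
Proof.
have [mS intS] := hS.
rewrite measurable_prod_measurableType => sW; move: W sW.
apply: dynkin_induction => /=.
- by rewrite measurable_prod_measurableType.
- move=> _ _ [A mA [B mB <-]] [A' mA' [B' mB' <-]].
  exists (A `&` A'); first exact: measurableI.
  exists (B `&` B'); first exact: measurableI.
  by rewrite setXI.
- have SE : (fun y => S y (ysection setT y)) = cst 1%E.
    by apply/funext => y /=; rewrite ysectionE preimage_setT probability_setT.
  split; first by exists set0; rewrite measure0 SE; split.
  by rewrite SE integral_cst// probability_setT mul1e; exact: probability_setT.
- move=> _ [A mA [B mB <-]]; have [N [mN N0 mSA]] := mS _ mA.
  have SE : (fun y => S y (ysection (A `*` B) y)) = (fun y => S y A) \_ B.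
    apply/funext => y; rewrite patchE; case: ifPn => yB.
      by rewrite in_ysectionX.
    by rewrite notin_ysectionX// measure0.
  split; last by rewrite SE -integral_mkcond intS.
  exists N; split => //; rewrite SE; apply/measurable_restrict => //.
    exact: measurableC.
  by apply: measurable_funS mSA => //; exact: measurableC.
- move=> W mW [[N [mN N0 mSW]] IW]; have mNC := measurableC mN.
  have SE y : S y (ysection (~` W) y) = (1 - S y (ysection W y))%E.
    have -> : ysection (~` W) y = ~` ysection W y by rewrite !ysectionE.
    apply: probability_setC.
    exact: measurable_ysection.
  have mSWC : measurable_fun (~` N) (fun y => S y (ysection (~` W) y)).
    by under eq_fun do rewrite SE; exact: emeasurable_funB.
  split; first by exists N.
  move: IW.
  rewrite (ge0_integral_setD_null mN N0)// (ge0_integral_setD_null (D := setT) mN N0)//.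
  rewrite !setTD => IW.
  have : (\int[Q]_(y in ~` N) (S y (ysection W y) + S y (ysection (~` W) y)) = 1)%E.
    rewrite (eq_integral (cst 1%E)); last first.
      move=> y _; rewrite SE addeC subeK// fin_num_measure//.
      exact: measurable_ysection.
    rewrite integral_cst// mul1e; transitivity (1 - Q N)%E; last by rewrite N0 sube0.
    exact: probability_setC.
  rewrite ge0_integralD// IW probability_setC// => <-.
  by rewrite addeC addeK// fin_num_measure.
- move=> F mF tF PF.
  have /choice[N hN] n : exists N, [/\ measurable N, Q N = 0%E &
     measurable_fun (~` N) (fun y => S y (ysection (F n) y))] := (PF n).1.
  (* A single null set off which all the sections of the [F n] have measurable mass. *)
  pose M := \bigcup_n N n.
  have mM : measurable M by apply: bigcupT_measurable => n; have [] := hN n.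
  have M0 : Q M = 0%E.
    apply: measure_negligible => //; apply: negligible_bigcup => n.
    by have [mN N0 _] := hN n; exact/negligibleP.
  have mSF n : measurable_fun (~` M) (fun y => S y (ysection (F n) y)).
    have [mN _ mSN] := hN n; apply: measurable_funS mSN; first exact: measurableC.
    by apply: subsetC; exact: bigcup_sup.
  have SE y : (S y (ysection (\bigcup_n F n) y) =
      \sum_(0 <= n <oo) S y (ysection (F n) y))%E.
    rewrite ysection_bigcup measure_semi_bigcup//.
    + by move=> n; exact: measurable_ysection.
    + exact: trivIset_ysection.
    + by apply: bigcupT_measurable => n; exact: measurable_ysection.
  have mMC := measurableC mM.
  split.
    exists M; split => //; under eq_fun do rewrite SE.
    exact: ge0_emeasurable_sum.
  under eq_integral do rewrite SE.
  rewrite (ge0_integral_setD_null mM M0); last first.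
    by move=> y _; exact: nneseries_ge0.
  rewrite setTD integral_nneseries// measure_semi_bigcup//; last first.
    exact: bigcupT_measurable.
  apply: eq_eseriesr => n _; apply: etrans (PF n).2.
  by rewrite [RHS](ge0_integral_setD_null mM M0)// setTD.
Qed.

Lemma nil_sets_negligible (E : set (X * Y)) : R.-negligible E -> nil_sets Q S E.
Proof.
move=> [W [mW W0 EW]].
have [[N [mN N0 mSW]]] := regular_conditional_probability_ysection mW.
rewrite W0 (ge0_integral_setD_null mN N0)// setTD.
rewrite (eq_integral (fun y => `|S y (ysection W y)|)%E); last first.
  by move=> y _; rewrite gee0_abs.
have mNC := measurableC mN.
move=> /(ae_eq_integral_abs _ mNC mSW)[M [mM M0 SM]].
(* [M] covers the points outside [N] at which the section of [W] has positive mass. *)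
exists (N `|` M); split; first exact: measurableU.
  apply: measure_negligible; first exact: measurableU.
  by apply: negligibleU; exact/negligibleP.
move=> y /not_orP[Ny My]; exists (ysection W y); split.
- exact: measurable_ysection.
- by apply: contrapT => SW; apply: My; apply: SM => /= /(_ Ny).
- exact: le_ysection.
Qed.

Lemma nil_setsS (E F : set (X * Y)) :
  E `<=` F -> nil_sets Q S F -> nil_sets Q S E.
Proof.
move=> EF [N [mN N0 nF]]; exists N; split => // y /nF.
by apply: negligibleS; exact: le_ysection.
Qed.

Lemma nil_sets_bigcup (F : nat -> set (X * Y)) :
  (forall n, nil_sets Q S (F n)) -> nil_sets Q S (\bigcup_n F n).
Proof.
move=> /choice[N hN]; exists (\bigcup_n N n).
have mN : measurable (\bigcup_n N n).
  by apply: bigcupT_measurable => n; have [] := hN n.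
split => //.
  apply: measure_negligible => //; apply: negligible_bigcup => n.
  by have [mNn N0 _] := hN n; exact/negligibleP.
move=> y Ny; rewrite ysection_bigcup; apply: negligible_bigcup => n.
by have [_ _ /(_ y)] := hN n; apply => Nny; apply: Ny; exists n.
Qed.

Lemma nil_setsU (E F : set (X * Y)) :
  nil_sets Q S E -> nil_sets Q S F -> nil_sets Q S (E `|` F).
Proof.
move=> nE nF; apply: (@nil_setsS _ (\bigcup_n (if n is 0 then E else F))).
  by move=> z [Ez|Fz]; [exists 0|exists 1].
by apply: nil_sets_bigcup => -[|n].
Qed.

Lemma nil_algebraP (E : set (X * Y)) :
  nil_algebra Q S E <-> exists2 W, measurable W & nil_sets Q S (W `+` E).
Proof.
split=> [[W mW [N nN <-]]|[W mW nWE]].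
  by exists W => //; rewrite setYA setYK set0Y.
by exists W => //; exists (W `+` E) => //; rewrite setYA setYK set0Y.
Qed.

(** The product-measurable part of the preimage under [g] differs from the preimage under [f] only
    inside the union of an [R]-negligible set and the set where [f] and [g] differ, both nil. *)
Lemma completed_algebra_gen_nil_algebra (f g : X * Y -> K) :
  measurable_wrt (completed_algebra_gen R) g ->
  nil_sets Q S [set z | f z <> g z] -> measurable_wrt (nil_algebra Q S) f.
Proof.
move=> mg nfg B mB; have [W mW [M nM WM]] := mg _ mB.
apply/nil_algebraP; exists W => //.
apply: nil_setsS (nil_setsU (nil_sets_negligible nM) nfg) => z.
have [fgz [[Wz fz]|[fz Wz]]|fgz _] := pselect (f z = g z); last by right.
- by exfalso; apply: fz; rewrite /= fgz; have : (W `|` M) z by [left]; rewrite WM.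
- by left; have [//|//] : (W `|` M) z by rewrite WM /= -fgz.
Qed.

(** For each rational q, the set where [f] exceeds q is a measurable set up to a nil set. The
    supremum of the q whose measurable set contains z is a measurable function of z, and it equals
    [f] off the countable union of the nil errors. *)
Lemma nil_algebra_measurable_version (f : X * Y -> K) :
  measurable_wrt (nil_algebra Q S) f ->
  exists2 g : X * Y -> K, measurable_fun setT g &
    nil_sets Q S [set z | f z <> g z].
Proof.
move=> mf.
(* An enumeration of the rationals; the default 0 merely repeats a value. *)
pose r n : K := ratr (odflt 0 (unpickle n)).
have /choice[W hW] n : exists W, measurable W /\
    nil_sets Q S (W `+` [set z | r n < f z]).
  by have /nil_algebraP[W mW nW] := measurable_wrt_gt (r n) mf; exists W.
pose u n (z : X * Y) : \bar K := if z \in W n then (r n)%:E else -oo%E.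
have mu n : measurable_fun setT (u n).
  apply: measurable_fun_ifT => //; apply: (measurable_fun_bool true).
  rewrite setTI (_ : _ @^-1` _ = W n); first by have [] := hW n.
  by apply/seteqP; split => z /= ; [move/set_mem|move/mem_set].
(* An infinite supremum is sent to 0 by [fine]; this happens only on the nil set of errors. *)
exists (fun z => fine (esups (u ^~ z) 0%N)).
  apply: measurableT_comp; first exact: fine_measurable.
  exact: measurable_fun_esups.
apply: nil_setsS (nil_sets_bigcup (fun n => (hW n).2)) => z fz.
apply: contrapT => nz; apply: fz.
have uE n : u n z = if r n < f z then (r n)%:E else -oo%E.
  rewrite /u; have [rf|rf] := ifPn (r n < f z).
    rewrite mem_set//; apply: contrapT => Wz.
    by apply: nz; exists n => //; right.
  rewrite memNset// => Wz; apply: nz; exists n => //; left; split => //.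
  exact/negP.
suff -> : esups (u ^~ z) 0%N = (f z)%:E by [].
apply: le_anti; apply/andP; split.
  apply: ge_ereal_sup => _ [n _ <-]; rewrite uE.
  by case: ifPn => [/ltW|_]; [rewrite lee_fin|exact: leNye].
apply/lee_subgt0Pr => e e0.
have efz : f z - e < f z by rewrite ltrBlDr ltrDl.
have [q] := rat_in_itvoo efz; rewrite in_itv/= => /andP[eq qf].
have rq : r (pickle q) = ratr q by rewrite /r pickleK.
apply: (@le_trans _ _ (ratr q)%:E); first by rewrite -EFinB lee_fin ltW.
apply: ereal_sup_ubound; exists (pickle q) => //.
by rewrite uE rq qf.
Qed.

End disintegration.

Lemma measurable_neq_fun (K : realType) (d : measure_display)
    (T : measurableType d) (f g : T -> K) :
  measurable_fun setT f -> measurable_fun setT g ->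
  measurable [set x | f x <> g x].
Proof.
move=> mf mg; have mfg := measurable_funB mf mg.
have -> : [set x | f x <> g x] = ~` ((f \- g) @^-1` [set 0]).
  apply/seteqP; split => x /= fg; first by move/eqP; rewrite subr_eq0 => /eqP.
  by move=> fgE; apply: fg; rewrite fgE subrr.
apply: measurableC; rewrite -[_ @^-1` _]setTI; exact: mfg.
Qed.

(** * Functions induced by a lower density *)

Lemma lower_density_sub (K : realType) (T : Type) (D : set (set T))
    (m : set T -> \bar K) (delta : set T -> set T) (A B : set T) :
  lower_density D m delta ->
  D A -> D B -> A `<=` B -> delta A `<=` delta B.
Proof.
move=> [_ _ _ _ deltaI] DA DB /setIidl AB z.
by rewrite -{1}AB deltaI//; exact: subIsetr.
Qed.

Section lift_fun.
Context (K : realType) (T : Type) (D : set (set T)) (m : set T -> \bar K).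
Variable delta : set T -> set T.
Hypothesis ldelta : lower_density D m delta.

Variable f : T -> K.
Hypotheses (mf : measurable_wrt D f) (bf : bounded_fun f).

Lemma has_sup_lift_fun z : has_sup [set r : K | delta [set t | r < f t] z].
Proof.
have [_ _ delta0 deltaT _] := ldelta.
have [M fM] : exists M, forall t, `|f t| <= M.
  (* [bounded_fun] supplies a threshold of which only the strictly larger numbers are known to be
     bounds. *)
  have [M [_ fM]] := bf; exists (M + 1) => t.
  by apply: fM => //; rewrite ltrDl.
split.
  exists (- M - 1) => /=.
  have -> : [set t | - M - 1 < f t] = setT.
    apply/seteqP; split => // t _ /=.
    have := fM t; rewrite ler_norml => /andP[+ _]; apply: lt_le_trans.
    by rewrite ltrBlDr ltrDl.
  by rewrite deltaT.
exists M => r /= dz; rewrite leNgt; apply/negP => Mr; move: dz.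
have -> : [set t | r < f t] = set0.
  apply/seteqP; split => // t /=.
  have := fM t; rewrite ler_norml => /andP[_ ftM].
  by rewrite ltNge (le_trans ftM)// ltW.
by rewrite delta0.
Qed.

Lemma lift_fun_ge r z : delta [set t | r < f t] z -> r <= lift_fun delta f z.
Proof. by move=> dz; apply: ub_le_sup => //; have [] := has_sup_lift_fun z. Qed.

(** The level is lowered to a rational by monotonicity of [delta]; rationality makes the union in
    [measurable_wrt_lift_fun] countable. *)
Lemma lt_lift_fun r z : r < lift_fun delta f z ->
  exists2 q : rat, r < ratr q & delta [set t | ratr q < f t] z.
Proof.
have [ne _] := has_sup_lift_fun z.
move=> /(sup_gt ne)[s /= ds rs].
have [q] := rat_in_itvoo rs; rewrite in_itv/= => /andP[rq qs].
exists q => //; move: z ds {ne}.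
apply: (lower_density_sub ldelta); [exact: measurable_wrt_gt..|].
by move=> t /=; exact: lt_trans.
Qed.

Section pullback.
Context (U : Type) (D' : set (set U)) (j : U -> T).
Hypothesis sD' : sigma_algebra setT D'.
Hypothesis jdelta : forall r, D' (j @^-1` delta [set t | r < f t]).

(** Strict superlevel sets are countable unions of lifted sets at larger rational levels. The map
    [j] will be the identity for joint measurability and [pair^~ y] for sections. *)
Lemma measurable_wrt_lift_fun : measurable_wrt D' (lift_fun delta f \o j).
Proof.
have [D'0 _ D'U] := sD'.
apply: measurable_wrt_ray => // r.
pose q n : K := ratr (odflt 0 (unpickle n)).
have -> : [set u | r < (lift_fun delta f \o j) u] =
    \bigcup_n (if r < q n then j @^-1` delta [set t | q n < f t] else set0).
  apply/seteqP; split => [u /lt_lift_fun[p rp dp]|u [n _]].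
    by exists (pickle p) => //; rewrite /q pickleK/= rp.
  by case: ifPn => // rq /lift_fun_ge; exact: lt_le_trans.
by apply: D'U => n; case: ifPn.
Qed.

(** The superlevel sets of [h] are not known to be fixed by [sigma], but they are sandwiched between
    fixed sets: the one at level r lies inside the lifted set at level r and contains those at
    larger levels. Monotonicity of [sigma] then determines the supremum. *)
Lemma lift_fun_invariant (m' : set U -> \bar K) (sigma : set U -> set U) :
  lower_density D' m' sigma ->
  (forall r, sigma (j @^-1` delta [set t | r < f t]) =
             j @^-1` delta [set t | r < f t]) ->
  lift_fun sigma (lift_fun delta f \o j) = lift_fun delta f \o j.
Proof.
move=> lsigma sigmaE; set h := lift_fun delta f \o j.
have D'h r : D' [set u | r < h u].
  by apply: measurable_wrt_gt; exact: measurable_wrt_lift_fun.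
have lower r u : r < h u -> sigma [set v | r < h v] u.
  move=> /lt_lift_fun[p rp dp].
  have sub : j @^-1` delta [set t | ratr p < f t] `<=` [set v | r < h v].
    by move=> v /lift_fun_ge; exact: lt_le_trans.
  by have := lower_density_sub lsigma (jdelta _) (D'h r) sub; rewrite sigmaE; apply.
have upper r u : sigma [set v | r < h v] u -> r <= h u.
  have sub : [set v | r < h v] `<=` j @^-1` delta [set t | r < f t].
    move=> v /lt_lift_fun[p rp] /=.
    apply: (lower_density_sub ldelta); [exact: measurable_wrt_gt..|].
    by move=> t /=; exact: lt_trans.
  move=> /(lower_density_sub lsigma (D'h r) (jdelta r) sub).
  by rewrite sigmaE; exact: lift_fun_ge.
apply/funext => u; rewrite /lift_fun; apply: le_anti; apply/andP; split.
  apply: ge_sup; last by move=> r /upper.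
  by exists (h u - 1); apply: lower; rewrite ltrBlDr ltrDl.
rewrite leNgt; apply/negP => sh.
have ub : has_ubound [set r | sigma [set v | r < h v] u].
  by exists (h u) => r /upper.
(* The midpoint is below [h u], so [lower] puts it in the set, yet it exceeds the supremum. *)
have [lt1 lt2] := midf_lt sh.
have := ub_le_sup ub (lower _ _ lt2).
by rewrite leNgt lt1.
Qed.

End pullback.

End lift_fun.

(** This is the shape of the preimage of [B] under a function equal to [phi n] on each [Om n] and to
    [f] off their union. *)
Lemma sigma_algebra_glue (T I : Type) (D : set (set T)) (Om : nat -> set T)
    (phi : nat -> T -> I) (f : T -> I) (B : set I) :
  sigma_algebra setT D -> (forall n, D (Om n)) ->
  (forall n, D (phi n @^-1` B)) -> D (f @^-1` B) ->
  D ((\bigcup_n (Om n `&` phi n @^-1` B)) `|` (f @^-1` B `\` \bigcup_n Om n)).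
Proof.
move=> sD DOm Dphi Df; have [_ DC DU] := sD.
apply: sigma_algebraU => //.
  by apply: DU => n; exact: sigma_algebraI.
rewrite setDE; apply: sigma_algebraI => //.
by rewrite -setTD; apply: DC; exact: DU.
Qed.

(** * Measurable versions of processes and modifications by liftings *)

Section processes.
Context (K : realType) (d1 d2 : measure_display).
Context (X : measurableType d1) (Y : measurableType d2).
Variables (P : probability X K) (Q : probability Y K).
Variables (R : probability (X * Y)%type K) (S : Y -> probability X K).
Hypothesis hR : skew_product P Q R.
Hypothesis hS : regular_conditional_probability Q R S.

(** The cylinder over [N] is [R]-null because the second marginal of [R] is [Q]. *)
Lemma completed_algebra_gen_off_null (N : set Y) (A E : set (X * Y)) :
  measurable N -> Q N = 0%E -> completed_algebra_gen R A ->
  (forall x y, ~ N y -> A (x, y) <-> E (x, y)) -> completed_algebra_gen R E.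
Proof.
move=> mN N0 cA AE; apply: completed_algebra_gen_setY cA _.
exists (setT `*` N); split; first exact: measurableX.
  by rewrite -N0; exact: hR.2.
move=> [x y] AEz; split => //=; apply: contrapT => /AE{}AE.
by case: AEz => -[+ nz]; apply: contra_not nz => /AE.
Qed.

Lemma equivalent_measurable_version (xi : Y -> X -> K) : process xi ->
  measurable_wrt (nil_algebra Q S) (process_fun xi) ->
  exists theta : Y -> X -> K,
    [/\ process theta, measurable_process R theta &
        equivalent_processes S xi theta].
Proof.
move=> pxi /nil_algebra_measurable_version[g mg [N [mN N0 nfg]]].
pose theta y := if y \in N then xi y else fun x => g (x, y).
exists theta; have ptheta : process theta.
  move=> y; rewrite /theta; case: ifPn => // _.
  exact: measurable_fun_pair1.
split => //.
- move=> B mB; have mgB := measurable_wrt_measurable_fun R mg mB.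
  apply: (completed_algebra_gen_off_null mN N0 mgB) => x y Ny.
  by rewrite /process_fun/theta/= memNset.
- move=> y; have [Ny|Ny] := pselect (N y).
    have -> : [set x | xi y x <> theta y x] = set0; last exact: measure0.
    by apply/seteqP; split => // x; rewrite /theta/= mem_set.
  apply: measure_negligible; first exact: measurable_neq_fun.
  apply: negligibleS (nfg _ Ny) => x /=; rewrite /theta memNset// => xg.
  exact/ysectionP.
Qed.

Lemma nil_sets_neq_equivalent (xi theta : Y -> X -> K) :
  process xi -> process theta -> equivalent_processes S xi theta ->
  nil_sets Q S [set z | process_fun xi z <> process_fun theta z].
Proof.
move=> pxi ptheta xitheta; exists set0; split => // y _.
exists [set x | xi y x <> theta y x]; split => //.
  exact: measurable_neq_fun.
by move=> x /ysectionP.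
Qed.

Variables (tau : Y -> set X -> set X) (sigma : Y -> set X -> set X).
Variable pi : set (X * Y) -> set (X * Y).
Hypothesis hpi : admissible_liftings Q S R tau sigma pi.

(** Sections of the lifted superlevel sets of [f] are fixed by [sigma y], so [lift_fun_invariant]
    with [j] equal to [pair^~ y] absorbs the second lift. *)
Lemma bounded_modificationE (f : X * Y -> K) (N : set Y) (psi : X * Y -> K) :
  bounded_modification Q S sigma pi f N psi ->
  [/\ measurable_wrt (completed_algebra_gen R) (lift_fun pi f),
      forall y, measurable_wrt (completed_algebra_gen (S y))
        (lift_fun pi f \o pair^~ y) &
      forall x y, ~ N y -> psi (x, y) = lift_fun pi f (x, y)].
Proof.
have [hsigma [[lpi _] hpiE]] := hpi.
move=> [[mf bf] _ _ psiE _].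
have Df r : nil_algebra Q S [set t | r < f t] by exact: measurable_wrt_gt.
have cS y r : completed_algebra_gen (S y) (pair^~ y @^-1` pi [set t | r < f t]).
  by have [_ /(_ y)[+ _] _] := hpiE _ (Df r); rewrite ysectionE.
split.
- apply: (measurable_wrt_lift_fun lpi mf bf (j := id)).
    exact: sigma_algebra_completed_algebra_gen.
  by move=> r; have [] := hpiE _ (Df r).
- move=> y; apply: (measurable_wrt_lift_fun lpi mf bf) => //.
  exact: sigma_algebra_completed_algebra_gen.
- move=> x y Ny; rewrite psiE//.
  have := @lift_fun_invariant _ _ _ _ _ lpi _ mf bf _ _ (pair^~ y)
    (sigma_algebra_completed_algebra_gen (S y)) (cS y) _ _ (hsigma y).1.1.
  move=> /(_ _)/(congr1 (@^~ x)); apply => r.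
  by have [_ /(_ y)[_ +] _] := hpiE _ (Df r); rewrite ysectionE.
Qed.

Lemma glued_modification_measurable (xi theta : Y -> X -> K) :
  process xi -> measurable_process R xi ->
  glued_modification Q S sigma pi (process_fun xi) (process_fun theta) ->
  completed_process S theta /\ measurable_process R theta.
Proof.
have [_ [[_ piC] hpiE]] := hpi.
move=> pxi mxi [W [N [psin [[_ nOm _ _ _] bmod thetaE thetaE']]]].
pose M := \bigcup_n N n.
pose phi n := lift_fun pi (fun z => process_fun xi z * \1_(W n) z).
have mM : measurable M.
  by apply: bigcupT_measurable => n; have [_ []] := bmod n.
have M0 : Q M = 0%E.
  apply: measure_negligible => //; apply: negligible_bigcup => n.
  by have [_ [mN N0] _ _ _] := bmod n; exact/negligibleP.
have thetaM y : M y -> theta y = xi y.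
  move=> [n _ Ny]; apply/funext => x.
  by apply: (thetaE' x y); left; exists n.
(* Off the null cylinder over [M], preimages under [theta] have the glued form. The same set serves
   both claims: through its sections for the [S y], and modulo the cylinder for [R]. *)
have thetaP B x y : ~ M y ->
  ((\bigcup_n (pi (W n) `&` phi n @^-1` B)) `|`
   (process_fun xi @^-1` B `\` \bigcup_n pi (W n))) (x, y) <->
  B (theta y x).
  move=> My; have NM n : ~ N n y by move=> Nn; apply: My; exists n.
  have pE n : pi (W n) (x, y) -> theta y x = phi n (x, y).
    move=> pxy; have [_ _ psinE] := bounded_modificationE (bmod n).
    exact: etrans (thetaE n x y pxy NM) (psinE x y (NM n)).
  have [[n pn]|np] := pselect (exists n, pi (W n) (x, y)).
    split=> [[[k _ [pk]]|[_ []]]|Bt].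
    + by rewrite /= -pE.
    + by exists n.
    + by left; exists n => //; split => //=; rewrite -pE.
  have tE : theta y x = xi y x.
    apply: (thetaE' x y); right => n; rewrite piC// => pn.
    by apply: np; exists n.
  split=> [[[k _ [pk _]]|[Bx _]]|].
  + by exfalso; apply: np; exists k.
  + by rewrite tE.
  + by rewrite tE => Bx; right; split => // -[k _ pk]; apply: np; exists k.
split => [y B mB|B mB].
- have [My|My] := pselect (M y).
    by rewrite thetaM//; exact: (measurable_wrt_measurable_fun (S y) (pxi y) mB).
  have -> : theta y @^-1` B =
      (\bigcup_n (pair^~ y @^-1` pi (W n) `&` (phi n \o pair^~ y) @^-1` B)) `|`
      (xi y @^-1` B `\` \bigcup_n (pair^~ y @^-1` pi (W n))).
    by apply/seteqP; split => x /(thetaP B x y My).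
  apply: sigma_algebra_glue.
  + exact: sigma_algebra_completed_algebra_gen.
  + by move=> n; have [_ /(_ y)[+ _] _] := hpiE _ (nOm n); rewrite ysectionE.
  + by move=> n; have [_ /(_ y B mB)] := bounded_modificationE (bmod n).
  + exact: (measurable_wrt_measurable_fun (S y) (pxi y) mB).
- apply: (completed_algebra_gen_off_null mM M0) (thetaP B).
  apply: sigma_algebra_glue.
  + exact: sigma_algebra_completed_algebra_gen.
  + by move=> n; have [] := hpiE _ (nOm n).
  + by move=> n; have [/(_ B mB)] := bounded_modificationE (bmod n).
  + exact: mxi.
Qed.

Lemma bounded_modification_measurable (xi theta : Y -> X -> K) (N : set Y) :
  process xi ->
  bounded_modification Q S sigma pi (process_fun xi) N (process_fun theta) ->
  completed_process S theta /\ measurable_process R theta.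
Proof.
move=> pxi bmod; have [mR mS thetaE] := bounded_modificationE bmod.
have [_ [mN N0] _ _ thetaN] := bmod.
split => [y|B mB].
- have [Ny|Ny] := pselect (N y).
    have -> : theta y = xi y by apply/funext => x; exact: (thetaN x y).
    exact: measurable_wrt_measurable_fun.
  suff -> : theta y = lift_fun pi (process_fun xi) \o pair^~ y by [].
  by apply/funext => x; exact: (thetaE x y).
- apply: (completed_algebra_gen_off_null mN N0 (mR _ mB)) => x y Ny.
  by rewrite /= thetaE.
Qed.

End processes.

Theorem proposition4p1 (K : realType) (d1 d2 : measure_display)
    (X : measurableType d1) (Y : measurableType d2)
    (P : probability X K) (Q : probability Y K)
    (R : probability (X * Y)%type K) (S : Y -> probability X K)
    (tau : Y -> set X -> set X)
    (hR : skew_product P Q R)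
    (hS : regular_conditional_probability Q R S)
    (htau : forall y, lower_density measurable (S y) (tau y))
    (hadm : equi_admissible S tau) :
  (forall xi : Y -> X -> K, process xi ->
     ((exists theta : Y -> X -> K,
         [/\ process theta, measurable_process R theta &
             equivalent_processes S xi theta]) <->
      measurable_wrt (nil_algebra Q S) (process_fun xi))) /\
  (forall (sigma : Y -> set X -> set X) (pi : set (X * Y) -> set (X * Y)),
     admissible_liftings Q S R tau sigma pi ->
     forall xi theta : Y -> X -> K,
       process xi -> measurable_process R xi ->
       modification Q S sigma pi xi theta ->
       completed_process S theta /\ measurable_process R theta).
Proof.
split => [xi pxi|sigma pi hpi xi theta pxi mxi [[N]|]].
- split=> [[theta [ptheta mtheta xitheta]]|].
    apply: (completed_algebra_gen_nil_algebra hS mtheta).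
    exact: nil_sets_neq_equivalent.
  exact: (equivalent_measurable_version hR).
- exact: (bounded_modification_measurable hR hpi).
- exact: (glued_modification_measurable hR hpi).
Qed.
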